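(* The power series equation $x=z-\sum_{j=2}^{\infty} z^{j}$ has reverse series $z=\sum_{n=0}^{\infty} s_n x^{n+1}$, where for each $n\ge0$, $s_n$ equals the number of subsets of pairwise non-crossing diagonals of a convex $(n+2)$-gon (equivalently, the number of all polygonal dissections of a convex $(n+2)$-gon), and $$s_n=\frac{1}{n+1}\sum_{\lambda} \binom{n+k}{k}\binom{k}{k_1,k_2,\dots,k_n},$$ the sum running over all partitions $\lambda$ of $n$, where $k_j$ denotes the number of parts of $\lambda$ of size $j$ and $k=\sum_j k_j$ the total number of parts.
   Context: The reverse series is the unique formal power series $z(x)$ with $z(0)=0$ satisfying the equation. $\binom{k}{k_1,\dots,k_n}=\frac{k!}{k_1!\cdots k_n!}$. By convention, for $n=0$ the degenerate $2$-gon has exactly one (empty) subset of diagonals, and the empty partition of $0$ contributes $1$. *)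

(* Defs.v *)
From HB Require Import structures.
From mathcomp Require Import all_boot all_order all_algebra.
From mathcomp Require Import boolp.

Set Implicit Arguments.
Unset Strict Implicit.
Unset Printing Implicit Defensive.

Import Order.TTheory GRing.Theory Num.Theory.
Local Open Scope ring_scope.

(* A formal power series is its sequence of coefficients. *)
Definition fps (R : comNzRingType) := nat -> R.

Section PowerSeries.
Variable R : comNzRingType.
Implicit Types f g z : fps R.

Definition fps_one : fps R := fun m => (m == 0%N)%:R.

Definition fps_X : fps R := fun m => (m == 1%N)%:R.

Definition fps_mul f g : fps R := fun m => \sum_(i < m.+1) f i * g (m - i)%N.

Definition fps_exp f (j : nat) : fps R := iter j (fps_mul f) fps_one.

(* Convergence of \sum_(j >= a) F j to S in the topology of formal power       *)
(* series: every coefficient of the partial sums is eventually that of S.     *)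
Definition fps_sum_from (a : nat) (F : nat -> fps R) (S : fps R) : Prop :=
  forall m, exists N0, forall N, (N0 <= N)%N -> \sum_(a <= j < N) F j m = S m.

(* z = z(x) solves x = z - \sum_(j >= 2) z ^ j and z(0) = 0. *)
Definition solves_reversion z : Prop :=
  z 0%N = 0 /\
  exists S, fps_sum_from 2 (fps_exp z) S /\ forall m, fps_X m = z m - S m.

(* The series \sum_(n >= 0) s_n x ^ (n + 1). *)
Definition shifted_series (s : nat -> nat) : fps R :=
  fun m => if m is n.+1 then (s n)%:R else 0.

End PowerSeries.

Section Polygons.
Variables (F : realFieldType) (N : nat).
Implicit Types (p q r x : 'rV[F]_2) (P : 'I_N -> 'rV[F]_2).
Implicit Types (d e : 'I_N * 'I_N) (D : {set 'I_N * 'I_N}).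

(* Twice the signed area of the triangle p q r: positive iff r lies strictly  *)
(* to the left of the oriented line from p to q.                              *)
Definition orient p q r : F :=
  (q 0 0 - p 0 0) * (r 0 1 - p 0 1) - (q 0 1 - p 0 1) * (r 0 0 - p 0 0).

(* Vertices are listed counterclockwise; ordS is the cyclic successor. The    *)
(* condition is void for the degenerate 2-gon.                                *)
Definition convex_polygon P : Prop :=
  forall i k, k != i -> k != ordS i -> 0 < orient (P i) (P (ordS i)) (P k).

(* A diagonal joins two distinct non-adjacent vertices; it is encoded by its  *)
(* endpoints in increasing order, so each diagonal is counted once.           *)
Definition is_diagonal d : bool :=
  [&& (d.1 < d.2)%N, d.2 != ordS d.1 & d.1 != ordS d.2].

Definition open_segment p q x : Prop :=
  exists2 t : F, 0 < t < 1 & x = (1 - t) *: p + t *: q.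

Definition crossing P d e : Prop :=
  exists2 x, open_segment (P d.1) (P d.2) x & open_segment (P e.1) (P e.2) x.

Definition dissection P D : Prop :=
  {in D, forall d, is_diagonal d} /\
  {in D &, forall d e, d != e -> ~ crossing P d e}.

Definition num_dissections P : nat :=
  #|[set D : {set 'I_N * 'I_N} | `[< dissection P D >]]|.

End Polygons.

Definition is_partition (n : nat) (l : seq nat) : bool :=
  [&& sorted geq l, 0%N \notin l & sumn l == n].

(* A partition of n has at most n parts, all at most n, so the partitions of  *)
(* n are among the finitely many sequences in n.-bseq 'I_n.+1.                *)
Definition parts (n : nat) (l : n.-bseq 'I_n.+1) : seq nat := map val l.

Definition num_parts (l : seq nat) (j : nat) : nat := count_mem j l.

Definition multinomial (n k : nat) (ks : nat -> nat) : rat :=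
  (k`!)%:R / \prod_(1 <= j < n.+1) ((ks j)`!)%:R.

(* Main.v *)
Require Import Defs.
From mathcomp Require Import all_boot all_order all_algebra.
From mathcomp Require Import zify ring lra boolp.
Set Implicit Arguments.
Unset Strict Implicit.
Unset Printing Implicit Defensive.
Import Order.TTheory GRing.Theory Num.Theory.

(* Split a dissection of the polygon on the vertices a, ..., b at the last    *)
(* vertex c < b joined to a: left of c the chord (a, c) is forced, right of c *)
(* the chord (c, b) is free, so z = x + z (2 z - x). Multiplying              *)
(* z - x = z ^ 2 + z ^ 3 + ... by 1 - z gives the same equation. In a convex  *)
(* polygon three vertices in increasing order are positively oriented         *)
(* (transitivity of the angular order around a vertex), so that diagonals     *)
(* cross exactly when their endpoints interleave. For the closed formula,     *)
(* Lagrange inversion of x = z (1 - g(z)) with g = x + x ^ 2 + ... gives      *)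
(* s_n = [x ^ n] (1 - g) ^ - (n + 1) / (n + 1), where [x ^ n] g ^ k counts    *)
(* the compositions of n into k parts; grouping the compositions by their     *)
(* underlying partition yields the multinomial coefficients.                  *)

(** Polygons, series and closed formula all meet in one sequence, [schroeder]. On the polygon side
    its recurrence is the split at the [last_neighbor] ([card_open_dissections_split]). On the
    series side it is the coefficient form of z = x + z (2 z - x), where each coefficient is
    determined by earlier ones ([solves_reversionP], [schroeder_quadratic],
    [quadratic_reversion_uniq]). The two agree because 2 z - x counts dissections whose base chord
    may be present or absent, the - x correcting the case where the base is a side.

    Geometry enters only to show that crossing means interleaving ([interleaved_crossing],
    [noninterleaved_noncrossing]). The closed formula uses no polygons: [fps_exp_lagrange] treats
    all powers of z at once, and [geom_coef_partitions] turns compositions into partitions. *)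

Fixpoint schroeder_upto n : nat -> nat :=
  if n is m.+1 then
    let s := schroeder_upto m in
    fun i => if (i <= m) then s i else
      (\sum_(j < m.+1) s j * ((m - j != 0).+1 * s (m - j)))
  else fun=> 1.

(** The recurrence refers to all earlier terms, so [schroeder_upto n] acts as a table that is valid
    for indices up to [n]. *)
Definition schroeder n := schroeder_upto n n.

Lemma schroeder_uptoE n i : (i <= n) -> schroeder_upto n i = schroeder i.
Proof.
elim: n => [|n IHn] lein; first by have ->: i = 0 by lia.
case: (ltngtP i n.+1) lein => // [ltin|->] _; last by [].
by rewrite /= ifT // IHn.
Qed.

Lemma schroederS n : schroeder n.+1 =
  (\sum_(j < n.+1) schroeder j * ((n - j != 0).+1 * schroeder (n - j))).
Proof.
rewrite {1}/schroeder /= ltnn; apply: eq_bigr => -[j ltjn] _ /=.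
by rewrite !schroeder_uptoE //; lia.
Qed.

(** * Combinatorial count of non-crossing sets of chords *)

Section Count.
Variables (N : nat).
Implicit Types (a b c : 'I_N) (d e : 'I_N * 'I_N) (D A B : {set 'I_N * 'I_N}).

(** Only the case where [d] starts first is tested; [noncrossing] ranges over both orders of each
    pair, which restores symmetry. *)
Definition interleaved (d e : 'I_N * 'I_N) : bool :=
  [&& d.1 < e.1, e.1 < d.2 & d.2 < e.2].

Definition noncrossing D :=
  [forall d in D, forall e in D, ~~ interleaved d e].

Lemma noncrossingP D :
  reflect {in D &, forall d e, ~~ interleaved d e} (noncrossing D).
Proof.
apply: (iffP forall_inP) => [ncD d e dD eD | ncD d dD].
  exact: (forall_inP (ncD d dD)).
by apply/forall_inP => e; apply: ncD.
Qed.

Lemma noncrossingS A B : A \subset B -> noncrossing B -> noncrossing A.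
Proof.
move=> /subsetP sAB /noncrossingP ncB; apply/noncrossingP => d e dA eA.
by apply: ncB; apply: sAB.
Qed.

Definition chords a b :=
  [set d : 'I_N * 'I_N | [&& a <= d.1, d.1.+1 < d.2 & d.2 <= b]].

Definition dissections a b :=
  [set D : {set 'I_N * 'I_N} | (D \subset chords a b) && noncrossing D].

Definition open_dissections a b :=
  [set D in dissections a b | (a, b) \notin D].

(** A side counts as a chord that is always drawn, so that the piece cut off by (a, c) has the same
    description when c follows a. *)
Definition closed_dissections a b :=
  [set D in dissections a b | (b == a.+1 :> nat) || ((a, b) \in D)].

Lemma edge_notin_dissection a b D :
  b = a.+1 :> nat -> D \in dissections a b -> (a, b) \notin D.
Proof.
move=> ba; rewrite inE => /andP[/subsetP sD _].
by apply/negP => /sD; rewrite inE /=; lia.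
Qed.

Lemma dissections_edge a b : b = a.+1 :> nat -> #|dissections a b| = 1%N.
Proof.
move=> ba; apply/eqP/cards1P; exists set0; apply/setP => D; rewrite !inE.
apply/andP/eqP => [[/subsetP sD _] | ->].
  by apply/setP => d; rewrite inE; apply/negP => /sD; rewrite inE; lia.
by rewrite sub0set; split=> //; apply/noncrossingP => d e; rewrite inE.
Qed.

Lemma open_dissections_edge a b :
  b = a.+1 :> nat -> open_dissections a b = dissections a b.
Proof.
move=> ba; apply/setP => D; rewrite inE andb_idr //.
exact: edge_notin_dissection.
Qed.

(** Adding or removing (a, b) is a bijection, since no chord on the vertices a, ..., b interleaves
    with it; for a side both sets are all of [dissections a b]. *)
Lemma card_closed_dissections a b : (a < b)%N ->
  #|closed_dissections a b| = #|open_dissections a b|.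
Proof.
move=> ltab; case: (altP (b =P a.+1 :> nat)) => [ba|nba].
  rewrite open_dissections_edge //; apply: eq_card => D.
  by rewrite [LHS]inE ba eqxx andbT.
have dS D : (a, b) |: D \in dissections a b = (D \in dissections a b).
  rewrite !inE subUset sub1set inE /= leqnn leqnn andbT.
  have -> : a.+1 < b by rewrite ltn_neqAle eq_sym nba.
  apply: andb_id2l => /subsetP sD.
  apply/idP/idP => [|/noncrossingP ncD]; first exact/noncrossingS/subsetUr.
  apply/noncrossingP => d e /setU1P[->|dD] /setU1P[->|eD]; last exact: ncD.
  - by rewrite /interleaved /=; lia.
  - by have := sD _ eD; rewrite /interleaved inE /=; lia.
  - by have := sD _ dD; rewrite /interleaved inE /=; lia.
rewrite -(@card_in_imset _ _ (fun D => (a, b) |: D) (open_dissections a b)).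
  apply: eq_card => D; apply/idP/imsetP => [|[D' D'o ->]].
    rewrite inE (negPf nba) /= => /andP[Dd abD]; exists (D :\ (a, b)).
      by rewrite inE -dS setD1K // Dd setD11.
    by rewrite setD1K.
  by move: D'o; rewrite inE => /andP[Dd _]; rewrite inE dS Dd setU11 orbT.
have notin D : D \in open_dissections a b -> (a, b) \notin D.
  by rewrite inE => /andP[].
move=> D1 D2 /notin n1 /notin n2 /(congr1 (fun D => D :\ (a, b))).
by rewrite !setU1K.
Qed.

(** The factor is 2 for a genuine chord (a, b), which may be present or absent, and 1 for a side. *)
Lemma card_dissections a b : (a < b)%N ->
  #|dissections a b| = ((b - a.+1 != 0).+1 * #|open_dissections a b|)%N.
Proof.
move=> ltab; case: (altP (b =P a.+1 :> nat)) => [ba|nba].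
  by rewrite ba subnn mul1n open_dissections_edge.
have -> /= : b - a.+1 != 0 by rewrite subn_eq0 -ltnNge ltn_neqAle eq_sym nba.
rewrite mul2n -addnn -{2}card_closed_dissections //.
rewrite -[LHS](cardsID [set D : {set 'I_N * 'I_N} | (a, b) \notin D]).
congr (_ + _); apply: eq_card => D; rewrite !inE //.
by rewrite (negPf nba) negbK /= andbC.
Qed.

(* (a, c) is the other side at a of the face that contains the side (a, b). *)
Definition last_neighbor a D c :=
  [&& (a < c)%N, (c == a.+1 :> nat) || ((a, c) \in D)
    & [forall d in D, (d.1 == a) ==> (d.2 <= c)%N]].

Lemma last_neighbor_uniq a D c1 c2 :
  last_neighbor a D c1 -> last_neighbor a D c2 -> c1 = c2.
Proof.
have le c c' : last_neighbor a D c -> last_neighbor a D c' -> (c <= c')%N.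
  case/and3P=> _ /orP[/eqP /= ->|acD] _ /and3P[ltac' _ /forall_inP max] //.
  by have := max _ acD; rewrite eqxx.
by move=> l1 l2; apply/val_inj/eqP; rewrite eqn_leq !le.
Qed.

Lemma last_neighbor_ex a b D : (a.+1 < b)%N -> D \in open_dissections a b ->
  exists2 c, last_neighbor a D c & (c < b)%N.
Proof.
move=> ltab; rewrite !inE => /andP[/andP[/subsetP sD _] abD].
have ltc0 : (a.+1 < N)%N by apply: ltn_trans (ltn_ord b).
pose Q c := (c == a.+1 :> nat) || ((a, c) \in D).
have Qc0 : Q (Ordinal ltc0) by rewrite /Q eqxx.
case: (arg_maxnP (fun c : 'I_N => val c) Qc0) => c Qc max.
exists c.
  apply/and3P; split=> //.
    by case/orP: Qc => [/eqP /= -> //|/sD]; rewrite inE /=; lia.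
  apply/forall_inP => -[a' j] dD /=; apply/implyP => /eqP a'a.
  by apply: max; rewrite /Q -a'a dD orbT.
case/orP: Qc => [/eqP /= -> //|acD]; have := sD _ acD; rewrite inE /=.
have : c != b by apply: contraNneq abD => <-.
by rewrite -val_eqE /=; lia.
Qed.

(** D is the disjoint union of its chords on a, ..., c and on c, ..., b: a chord from a ends at c or
    earlier by maximality, and one that starts strictly between a and c and ends beyond c would
    interleave with (a, c). *)
Lemma card_last_neighbor a b c : (a < c < b)%N ->
  #|[set D in open_dissections a b | last_neighbor a D c]| =
  (#|closed_dissections a c| * #|dissections c b|)%N.
Proof.
case/andP=> ltac ltcb; rewrite -cardsX.
pose f (AB : {set 'I_N * 'I_N} * {set 'I_N * 'I_N}) := AB.1 :|: AB.2.
have fI A B : A \subset chords a c -> B \subset chords c b ->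
    (A :|: B) :&: chords a c = A /\ (A :|: B) :&: chords c b = B.
  move=> /subsetP sA /subsetP sB.
  by split; apply/setP => d; rewrite 2!inE; have := sA d; have := sB d;
     rewrite !inE; case: (d \in A); case: (d \in B) => //=; lia.
rewrite -(@card_in_imset _ _ f); last first.
  move=> [A1 B1] [A2 B2] /setXP[/= A1d B1d] /setXP[/= A2d B2d] eqf.
  move: A1d A2d B1d B2d; rewrite !inE.
  move=> /andP[/andP[A1d _] _] /andP[/andP[A2d _] _] /andP[B1d _] /andP[B2d _].
  have [e1 e1'] := fI _ _ A1d B1d; have [e2 e2'] := fI _ _ A2d B2d.
  have restr X := congr1 (fun Y => Y :&: X) eqf; rewrite /f /= in restr.
  by congr (_, _); [rewrite -e1 restr e2 | rewrite -e1' restr e2'].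
apply: eq_card => D; apply/idP/imsetP; last first.
  case=> -[A B] /setXP[/=]; rewrite !inE.
  move=> /andP[/andP[/subsetP sA /noncrossingP ncA] acA].
  move=> /andP[/subsetP sB /noncrossingP ncB] ->; rewrite /f /=.
  apply/andP; split; [apply/andP; split; [apply/andP; split|] |].
  - apply/subsetP => d /setUP[/sA|/sB]; rewrite !inE; lia.
  - apply/noncrossingP => d e /setUP[dA|dB] /setUP[eA|eB].
    + exact: ncA.
    + by move: (sA _ dA) (sB _ eB); rewrite /interleaved !inE; lia.
    + by move: (sA _ eA) (sB _ dB); rewrite /interleaved !inE; lia.
    + exact: ncB.
  - by rewrite inE; apply/orP => -[/sA|/sB]; rewrite inE /=; lia.
  - apply/and3P; split=> //; first by rewrite inE orbA acA.
    apply/forall_inP => d /setUP[/sA|/sB]; rewrite inE -val_eqE /=; lia.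
rewrite inE => /andP[]; rewrite !inE => /andP[/andP[sD ncD] abD].
case/and3P=> _ acD /forall_inP maxc.
exists (D :&: chords a c, D :&: chords c b).
  apply/setXP; rewrite !inE /= !subsetIr /= !(noncrossingS _ ncD) ?subsetIl //.
  split=> //=; case/orP: acD => [-> //|acD].
  have := subsetP sD _ acD; rewrite !inE acD /= => /and3P[_ -> _].
  by rewrite !leqnn orbT.
rewrite /f /= -setIUr; apply/esym/setIidPl/subsetP => d dD.
have := subsetP sD _ dD; have := maxc _ dD; rewrite !inE -val_eqE /=.
case/orP: acD => [/eqP /= ca|acD]; first by lia.
have /noncrossingP/(_ _ _ acD dD) := ncD; rewrite /interleaved /=; lia.
Qed.

Lemma card_open_dissections_split a b : (a.+1 < b)%N ->
  #|open_dissections a b| =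
  \sum_(c : 'I_N | a < c < b) #|closed_dissections a c| * #|dissections c b|.
Proof.
move=> ltab; under eq_bigr do rewrite -card_last_neighbor //.
rewrite -sum1_card.
under [RHS]eq_bigr => c acb.
  rewrite -sum1_card.
  under eq_bigl do rewrite inE.
  rewrite big_mkcondr /=; over.
rewrite exchange_big /=; apply: eq_bigr => D Do.
have [c lc ltcb] := last_neighbor_ex ltab Do.
rewrite -big_mkcondr /= (bigD1 c) /=; last first.
  by rewrite lc ltcb !andbT; case/and3P: lc.
rewrite big1 // => c' /andP[/andP[_ lc'] /eqP[]].
exact: last_neighbor_uniq lc.
Qed.
Lemma card_open_dissections a b :
  (a < b)%N -> #|open_dissections a b| = schroeder (b - a.+1).
Proof.
move dab: (b - a.+1)%N => d; elim/ltn_ind: d a b dab => -[_|d IHd] a b dab ltab.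
  have ba : b = a.+1 :> nat by lia.
  by rewrite open_dissections_edge // dissections_edge.
rewrite card_open_dissections_split; last by lia.
rewrite schroederS.
have aN (j : 'I_d.+1) : (a.+1 + j < N)%N.
  by have := ltn_ord j; have := ltn_ord b; lia.
(* Here j = c - a - 1 is the number of vertices strictly between a and c. *)
rewrite (reindex_onto (fun j : 'I_d.+1 => Ordinal (aN j))
                      (fun c => inord (c - a.+1))) /=; last first.
  move=> c /andP[ltac ltcb]; apply: val_inj; rewrite /= inordK; lia.
apply: eq_big => [j | j _].
  rewrite -val_eqE /=; have ltj := ltn_ord j.
  by rewrite addKn inord_val eqxx andbT; lia.
have ltj := ltn_ord j.
rewrite card_closed_dissections /=; last by lia.
rewrite card_dissections /=; last by lia.
rewrite (IHd j) //=; [|lia|lia].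
rewrite (IHd (d - j)%N) //=; [|lia|lia|lia].
by congr (_ * (_.+1 * _)); congr (nat_of_bool (_ != _)); lia.
Qed.

End Count.

Local Open Scope ring_scope.

(** * The reversion equation and its quadratic form, modulo powers of x *)

Section Reversion.
Variable R : comNzRingType.
Implicit Types (z : fps R) (p q : {poly R}).

Definition fps_trunc N z : {poly R} := \poly_(i < N) z i.

Lemma coef_fps_exp N z j m :
  (m < N)%N -> fps_exp z j m = (fps_trunc N z ^+ j)`_m.
Proof.
elim: j m => [|j IHj] m lt_mN; first by rewrite expr0 coef1.
rewrite exprS coefM /fps_exp iterS; apply: eq_bigr => i _.
rewrite -IHj ?coef_poly; last by lia.
by rewrite ifT //; case: i => i /=; lia.
Qed.

Definition low_zero N p := forall i, (i < N)%N -> p`_i = 0.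

Lemma low_zeroD N p q : low_zero N p -> low_zero N q -> low_zero N (p + q).
Proof. by move=> p0 q0 i ltiN; rewrite coefD p0 // q0 // addr0. Qed.

Lemma low_zeroM N p q : low_zero N q -> low_zero N (p * q).
Proof.
move=> q0 i ltiN; rewrite coefM big1 // => j _.
by rewrite q0 ?mulr0 //; lia.
Qed.

Lemma low_zeroX N j p : p`_0 = 0 -> (N <= j)%N -> low_zero N (p ^+ j).
Proof.
move=> p0; elim: j N => [|j IHj] N leNj i ltiN; first by lia.
rewrite exprS coefM big1 // => -[k ltk] _ /=.
case: k ltk => [|k] ltk; first by rewrite p0 mul0r.
move: leNj ltiN ltk; rewrite ?ltnS => leNj ltiN ltk.
by rewrite (IHj N.-1) ?mulr0 //; lia.
Qed.

(** Without a constant term in p, the factor 1 - p is a unit modulo x^N. *)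
Lemma low_zero_onesub N p q :
  p`_0 = 0 -> low_zero N ((1 - p) * q) <-> low_zero N q.
Proof.
move=> p0; split=> [pq0|]; last exact: low_zeroM.
elim/ltn_ind=> i IHi ltiN; have := pq0 i ltiN.
rewrite mulrBl mul1r coefB coefM big_ord_recl p0 mul0r add0r big1 ?subr0 //.
by move=> [j ltji] _; rewrite IHi ?mulr0 // lift0 /=; lia.
Qed.

Lemma mul_onesub_geometric N p : (2 <= N)%N ->
  (1 - p) * (\sum_(2 <= j < N) p ^+ j) = p ^+ 2 - p ^+ N.
Proof.
move=> le2N; rewrite mulr_sumr (telescope_sumr_eq (fun j => - p ^+ j)) //.
  by rewrite opprK addrC.
by move=> j _; rewrite exprS; ring.
Qed.

(** Multiplying by the unit 1 - p collapses the geometric sum to p^2 - p^N, and p^N vanishes modulo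
    x^M. *)
Lemma fps_trunc_reversion N M z (p := fps_trunc M z) :
    z 0%N = 0 -> (2 <= N)%N -> (M <= N)%N ->
  low_zero M (p - 'X - \sum_(2 <= j < N) p ^+ j) <->
  low_zero M (p - 'X - p * (p *+ 2 - 'X)).
Proof.
move=> z0 le2N leMN.
have p0 : p`_0 = 0 by rewrite coef_poly z0 if_same.
rewrite -(low_zero_onesub _ _ p0) [(1 - p) * _]mulrBr mul_onesub_geometric //.
have -> : (1 - p) * (p - 'X) - (p ^+ 2 - p ^+ N) =
          p - 'X - p * (p *+ 2 - 'X) + p ^+ N by ring.
have pN0 := low_zeroX p0 leMN.
split=> [q0|q0]; last exact: low_zeroD.
rewrite -[X in low_zero _ X](addrK (p ^+ N)); apply: low_zeroD => // i ltiM.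
by rewrite coefN pN0 // oppr0.
Qed.

Definition quadratic_reversion z :=
  forall m, z m = fps_X R m + fps_mul z (fun i => z i *+ 2 - fps_X R i) m.

Lemma coefX_fps m : ('X : {poly R})`_m = fps_X R m.
Proof. exact: coefX. Qed.

Lemma quadratic_trunc z M :
  (forall m, (m < M)%N ->
    z m = fps_X R m + fps_mul z (fun i => z i *+ 2 - fps_X R i) m) <->
  low_zero M (fps_trunc M z - 'X - fps_trunc M z * (fps_trunc M z *+ 2 - 'X)).
Proof.
split=> zq m ltmM.
  apply/eqP; rewrite !coefB coefX_fps coef_poly ltmM coefM zq //.
  rewrite [fps_X R m + _]addrC addrK subr_eq0; apply/eqP/eq_bigr => i _.
  by rewrite coefB coefMn !coef_poly coefX_fps !ifT //; case: i => i /=; lia.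
apply/eqP; rewrite -subr_eq0 opprD addrA -(zq m ltmM) !coefB coefX_fps.
rewrite coef_poly ltmM coefM; apply/eqP; congr (_ - _); apply: eq_bigr => i _.
by rewrite coefB coefMn !coef_poly coefX_fps !ifT //; case: i => i /=; lia.
Qed.

Lemma coef_geometric_trunc z M N m : (m < M)%N ->
  (\sum_(2 <= j < N) fps_trunc M z ^+ j)`_m = \sum_(2 <= j < N) fps_exp z j m.
Proof.
move=> ltmM; rewrite coef_sum; apply: eq_bigr => j _.
by rewrite (coef_fps_exp _ _ ltmM).
Qed.

(** Convergence gives one bound per coefficient; arguing modulo x^M needs a common bound for
    finitely many of them. *)
Lemma sum_from_uniform a F S M : @fps_sum_from R a F S ->
  exists N0, forall N m, (N0 <= N)%N -> (m < M)%N ->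
    \sum_(a <= j < N) F j m = S m.
Proof.
move=> FS; elim: M => [|M [N0 IHM]]; first by exists 0%N.
have [N1 FS1] := FS M; exists (maxn N0 N1) => N m leN; rewrite ltnS leq_eqVlt.
by case/predU1P=> [->|ltmM]; [apply: FS1 | apply: IHM]; lia.
Qed.

Lemma solves_reversionP z :
  solves_reversion z <-> z 0%N = 0 /\ quadratic_reversion z.
Proof.
split=> [[z0 [S [zS XS]]] | [z0 zq]]; split=> //.
  move=> m; have [N0 zN0] := sum_from_uniform m.+1 zS.
  pose N := maxn N0 m.+2.
  have := @fps_trunc_reversion N m.+1 z z0 _ _.
  case=> [||Mq _]; [by lia | by lia |].
  apply: (proj2 (quadratic_trunc z m.+1)) => //; apply: Mq => i ltim.
  rewrite !coefB coef_geometric_trunc // zN0 //; last by lia.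
  by rewrite coefX_fps coef_poly ltim XS; ring.
exists (fun m => z m - fps_X R m); split=> [m|m]; last by rewrite subKr.
exists m.+2 => N leN.
have := @fps_trunc_reversion N m.+1 z z0 _ _.
case=> [||_ Mq]; [by lia | by lia |].
have /Mq/(_ m (ltnSn m)) := proj1 (quadratic_trunc z m.+1) (fun i _ => zq i).
rewrite !coefB coef_geometric_trunc // coefX_fps coef_poly ltnSn.
by move/eqP; rewrite subr_eq0 => /eqP <-.
Qed.

(** Both end terms of the product vanish, as z and 2 z - x have no constant term; so only
    coefficients up to m remain on the right. *)
Lemma quadratic_reversion_rec z m : z 0%N = 0 -> quadratic_reversion z ->
  z m.+1 = (m == 0%N)%:R +
    \sum_(i < m) z i.+1 * (z (m - i)%N *+ 2 - fps_X R (m - i)%N).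
Proof.
move=> z0 -> ; rewrite /fps_X /fps_mul big_ord_recl z0 mul0r add0r.
rewrite big_ord_recr /= /bump /= add1n subnn z0 mul0rn subrr mulr0 addr0.
by congr (_ + _); apply: eq_bigr => i _; rewrite /bump /= add1n subSS.
Qed.

Lemma quadratic_reversion_uniq z1 z2 :
    z1 0%N = 0 -> quadratic_reversion z1 ->
    z2 0%N = 0 -> quadratic_reversion z2 -> z1 =1 z2.
Proof.
move=> z10 q1 z20 q2; elim/ltn_ind=> -[_|m IHm]; first by rewrite z10 z20.
rewrite !quadratic_reversion_rec //; congr (_ + _).
by apply: eq_bigr => -[i ltim] _ /=; rewrite !IHm //; lia.
Qed.

End Reversion.

Lemma schroeder_quadratic (R : comNzRingType) :
  quadratic_reversion (shifted_series R schroeder).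
Proof.
case=> [|m]; rewrite /fps_X /fps_mul.
  by rewrite big_ord_recl big_ord0 /= mul0r !addr0.
rewrite big_ord_recl mul0r add0r big_ord_recr /= /bump /= add1n subnn mul0rn.
rewrite subrr mulr0 addr0; case: m => [|m]; first by rewrite big_ord0 addr0.
rewrite /= add0r schroederS natr_sum; apply: eq_bigr => -[j ltjm] _ /=.
rewrite /bump /= add1n subSS subSn; last by lia.
rewrite natrM eqSS; congr (_ * _).
(* The coefficient of x in 2 z - x is 2 - 1 = 1, matching the factor 1 for a side. *)
case: eqP => [->|_]; first by rewrite !mul1n mulr2n addrK.
by rewrite subr0 natrM mulr_natl.
Qed.

Lemma schroeder_reversion (R : comNzRingType) :
  solves_reversion (shifted_series R schroeder) /\
  forall z : fps R, solves_reversion z -> z =1 shifted_series R schroeder.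
Proof.
split=> [|z /solves_reversionP[z0 zq]].
  by apply/solves_reversionP; split=> //; apply: schroeder_quadratic.
exact: quadratic_reversion_uniq (schroeder_quadratic R).
Qed.

(** * In a convex polygon, diagonals cross exactly when their endpoints interleave *)

Section Geometry.
Variables (F : realFieldType) (N : nat).
Implicit Types (p q r u v x : 'rV[F]_2) (P : 'I_N -> 'rV[F]_2).

Lemma orientC p q r : orient q p r = - orient p q r.
Proof. by rewrite /orient; ring. Qed.

Lemma orient_rot p q r : orient q r p = orient p q r.
Proof. by rewrite /orient; ring. Qed.

Lemma orient_pp p r : orient p p r = 0.
Proof. by rewrite /orient; ring. Qed.

Lemma orient_convex p q u v (t : F) :
  orient p q ((1 - t) *: u + t *: v) =
  (1 - t) * orient p q u + t * orient p q v.
Proof. by rewrite /orient !mxE; ring. Qed.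

(* Pluecker relation between the vectors from o to p, q, r, u. *)
Lemma orient_trans o p q r u :
    0 < orient o u q -> 0 <= orient o u p -> 0 < orient o u r ->
    0 < orient o p q -> 0 < orient o q r -> 0 < orient o p r.
Proof.
move=> uq up ur pq qr; rewrite -(pmulr_rgt0 _ uq).
have -> : orient o u q * orient o p r =
    orient o u p * orient o q r + orient o u r * orient o p q.
  by rewrite /orient; ring.
by rewrite ltr_wpDl ?mulr_gt0 ?mulr_ge0 // ltW.
Qed.

(** Induction on k - j: convexity orders consecutive vertices as seen from i, and [orient_trans]
    chains them through k - 1. The side from i to i + 1 is the reference ray that keeps all
    directions within a half turn. *)
Lemma convex_polygon_orient P (i j k : 'I_N) :
  convex_polygon P -> (i < j)%N -> (j < k)%N -> 0 < orient (P i) (P j) (P k).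
Proof.
move=> Pcvx ltij ltjk.
have ordS_val (a : 'I_N) (b : nat) : (a < b)%N -> (b < N)%N ->
    val (ordS a) = a.+1.
  by move=> ltab ltbN; rewrite /= modn_small //; lia.
have edge (a c : 'I_N) : (i < a)%N -> val c = a.+1 ->
    0 < orient (P i) (P a) (P c).
  move=> ltia ca; have -> : c = ordS a.
    by apply: val_inj; rewrite ca (@ordS_val a c) // ca.
  have Sa : val (ordS a) = a.+1 by rewrite (@ordS_val a c) // ca.
  rewrite -orient_rot; apply: Pcvx; apply/eqP => /(congr1 val) /=.
    by lia.
  by rewrite -[RHS]/(val (ordS a)) Sa; lia.
pose u := ordS i; have Su : val u = i.+1 by apply: (@ordS_val i j).
have first_edge (a : 'I_N) : (i.+1 < a)%N -> 0 < orient (P i) (P u) (P a).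
  move=> lta; apply: Pcvx; apply/eqP => /(congr1 val) /=; first by lia.
  by rewrite -[RHS]/(val (ordS i)) Su; lia.
have first_edge_ge (a : 'I_N) : (i < a)%N -> 0 <= orient (P i) (P u) (P a).
  move=> lta; have [lt|ge] := ltnP i.+1 a; first by rewrite ltW ?first_edge.
  have -> : a = u by apply: val_inj; rewrite Su /=; lia.
  by rewrite -orient_rot orient_pp.
have [d] := ubnPeq (k - j.+1)%N; elim: d k ltjk => [|d IHd] k ltjk kd.
  by apply: edge => //=; lia.
have ltk' : (k.-1 < N)%N by have := ltn_ord k; lia.
pose k' := Ordinal ltk'.
apply: (@orient_trans _ _ (P k') _ (P u)).
- by apply: first_edge => /=; lia.
- exact: first_edge_ge.
- by apply: first_edge; lia.
- by apply: IHd => /=; lia.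
- by apply: edge => /=; lia.
Qed.

(** For a < c < b < d, the distances of a and b from the line cd are as C : D, and those of c and d
    from the line ab as A : B. This gives the parameters of the intersection point; A + B = C + D is
    twice the area of the quadrilateral. *)
Lemma interleaved_crossing P d e :
  convex_polygon P -> interleaved d e -> crossing P d e.
Proof.
move=> Pcvx /and3P[lt1 lt2 lt3]; move: d e lt1 lt2 lt3 => [a b] [c d] /=.
move=> ltac ltcb ltbd.
have acb := convex_polygon_orient Pcvx ltac ltcb.
have abd := convex_polygon_orient Pcvx (ltn_trans ltac ltcb) ltbd.
have acd := convex_polygon_orient Pcvx ltac (ltn_trans ltcb ltbd).
have cbd := convex_polygon_orient Pcvx ltcb ltbd.
set A := orient _ _ _ in acb; set B := orient _ _ _ in abd.
set C := orient _ _ _ in acd; set D := orient _ _ _ in cbd.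
have AB : 0 < A + B by rewrite addr_gt0.
have CD : 0 < C + D by rewrite addr_gt0.
have ABCD : A + B = C + D by rewrite /A /B /C /D /orient; ring.
exists ((1 - C / (C + D)) *: P a + (C / (C + D)) *: P b).
  exists (C / (C + D)) => //=.
  by rewrite divr_gt0 //= ltr_pdivrMr // mul1r ltrDl.
exists (A / (A + B)) => /=.
  by rewrite divr_gt0 //= ltr_pdivrMr // mul1r ltrDl.
apply/rowP => i; rewrite !mxE -ABCD.
have div (S t y w : F) : S != 0 ->
    S * ((1 - t / S) * y + t / S * w) = (S - t) * y + t * w by move=> ?; field.
apply: (mulfI (lt0r_neq0 AB)); rewrite !div ?lt0r_neq0 //.
have [->|->] : i = 0 \/ i = 1.
  by case: i => -[|[|//]] lti; [left|right]; apply: val_inj.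
all: by rewrite /A /B /C /orient; ring.
Qed.

(** The affine function [o] vanishes on the line of d, but at an interior point of e it is a
    positive combination of two values of the same weak sign, not both zero. *)
Lemma side_noncrossing P d e :
    let o := orient (P d.1) (P d.2) in
    (0 <= o (P e.1)) && (0 <= o (P e.2)) || 
    (o (P e.1) <= 0) && (o (P e.2) <= 0) ->
    o (P e.1) != 0 \/ o (P e.2) != 0 -> ~ crossing P d e.
Proof.
move=> o side nz [x [t _ xd] [t' /andP[t'0 t'1] xe]].
have : o x = 0.
  rewrite /o xd orient_convex -orient_rot -orient_rot orient_pp.
  by rewrite -orient_rot orient_pp !mulr0 addr0.
rewrite /o xe orient_convex -/o.
have t'1' : 0 < 1 - t' by rewrite subr_gt0.
have t0 : 0 < t' by [].
move=> xo; case/orP: side => /andP[o1 o2]; case: nz => nz.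
- have : 0 < o (P e.1) by rewrite lt0r nz.
  by nra.
- have : 0 < o (P e.2) by rewrite lt0r nz.
  by nra.
- have : o (P e.1) < 0 by rewrite lt_neqAle nz.
  by nra.
- have : o (P e.2) < 0 by rewrite lt_neqAle nz.
  by nra.
Qed.

(** Vertices strictly between a and b lie to the right of the line ab, those outside to its left.
    Without interleaving, both ends of e lie on one closed side, and d != e puts one of them off the
    line. *)
Lemma noninterleaved_noncrossing P (d e : 'I_N * 'I_N) :
    convex_polygon P -> (d.1 < d.2)%N -> (e.1 < e.2)%N -> d != e ->
    ~~ interleaved d e -> ~~ interleaved e d -> ~ crossing P d e.
Proof.
move: d e => [a b] [c d] Pcvx /= ltab ltcd neq nde ned.
have left (k : 'I_N) : (k < a)%N || (b < k)%N -> 0 < orient (P a) (P b) (P k).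
  case/orP=> [ltka|ltbk]; last exact: convex_polygon_orient.
  by rewrite orient_rot; apply: convex_polygon_orient.
have right (k : 'I_N) : (a < k < b)%N -> orient (P a) (P b) (P k) < 0.
  case/andP=> ltak ltkb; rewrite orientC oppr_lt0 -orient_rot.
  by apply: convex_polygon_orient.
have on_a : orient (P a) (P b) (P a) = 0 by rewrite orient_rot orient_pp.
have on_b : orient (P a) (P b) (P b) = 0.
  by rewrite -orient_rot orient_pp.
have leftE (k : 'I_N) : (k <= a)%N || (b <= k)%N ->
    0 <= orient (P a) (P b) (P k).
  rewrite leq_eqVlt [(b <= k)%N]leq_eqVlt -orbA => /orP[/eqP/val_inj->|].
    by rewrite on_a.
  rewrite orbCA => /orP[/eqP/val_inj<-|/left/ltW //]; by rewrite on_b.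
have rightE (k : 'I_N) : (a <= k <= b)%N -> orient (P a) (P b) (P k) <= 0.
  rewrite leq_eqVlt [(k <= b)%N]leq_eqVlt => /andP[/orP[/eqP/val_inj<-|ltak]].
    by rewrite on_a.
  case/orP=> [/eqP/val_inj->|ltkb]; first by rewrite on_b.
  by rewrite ltW ?right // ltak.
have nz (k : 'I_N) : k != a -> k != b -> orient (P a) (P b) (P k) != 0.
  move=> ka kb; have [lt|] := boolP ((k < a) || (b < k))%N.
    by rewrite lt0r_neq0 ?left.
  move=> ge; rewrite ltr0_neq0 ?right //.
  by move: ge ka kb; rewrite -!val_eqE /=; lia.
apply: side_noncrossing => /=.
  move: nde ned; rewrite /interleaved /= => nde ned; apply/orP.
  have [inside|outside] := boolP ((a <= c) && (d <= b))%N; [right|left].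
    by rewrite !rightE //; lia.
  have [ca|ac] := boolP ((c <= a) || (b <= c))%N.
    by rewrite !leftE //; lia.
  by rewrite !leftE //; lia.
have [cz|cz] := boolP ((c != a) && (c != b)).
  by case/andP: cz => ca cb; left; apply: nz.
right; apply: nz.
  by move: neq cz; rewrite xpair_eqE -!val_eqE /=; lia.
by move: neq cz; rewrite xpair_eqE -!val_eqE /=; lia.
Qed.

End Geometry.

(** The pair of first and last vertex is the side that closes the polygon; hence dissections of the
    polygon are the open ones. *)
Lemma is_diagonalE n (d : 'I_n.+2 * 'I_n.+2) :
  is_diagonal d = (d \in chords ord0 ord_max) && (d != (ord0, ord_max)).
Proof.
case: d => i j; rewrite /is_diagonal inE xpair_eqE -!val_eqE /=.
have lti := ltn_ord i; have ltj := ltn_ord j.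
have [ji|ltij] := leqP j i; first by lia.
rewrite modn_small; last by lia.
have [->|ltjn] := eqVneq (j : nat) n.+1; first by rewrite modnn; lia.
rewrite modn_small; lia.
Qed.

Lemma num_dissections_schroeder n (F : realFieldType)
    (P : 'I_n.+2 -> 'rV[F]_2) :
  convex_polygon P -> num_dissections P = schroeder n.
Proof.
move=> Pcvx; have := @card_open_dissections n.+2 ord0 ord_max isT.
rewrite /= subSS subn0 => <-; apply: eq_card => D; rewrite !inE.
apply/asboolP/andP;
  [move=> [diag ncross] | move=> [/andP[/subsetP sD /noncrossingP nc] nD]].
  split; last first.
    by apply/negP => /diag; rewrite is_diagonalE eqxx andbF.
  apply/andP; split.
    by apply/subsetP => d /diag; rewrite is_diagonalE => /andP[].
  apply/noncrossingP => d e dD eD; apply/negP => int.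
  apply: (ncross d e dD eD); last exact: interleaved_crossing.
  by apply: contraTneq int => ->; rewrite /interleaved ltnn.
have lt (d : 'I_n.+2 * 'I_n.+2) : d \in D -> (d.1 < d.2)%N.
  by move/sD; rewrite inE => /and3P[_ /ltnW].
split=> [d dD | d e dD eD neq].
  by rewrite is_diagonalE sD //=; apply: contraNneq nD => <-.
by apply: noninterleaved_noncrossing; rewrite ?lt ?nc.
Qed.

(** * Compositions of n, and the powers of 1 - g *)

Fixpoint compositions k n : seq (seq nat) :=
  if k is k'.+1 then [seq i :: t | i <- iota 1 n,
                                t <- compositions k' (n - i)%N]
  else if n is 0%N then [:: [::]] else [::].

Lemma mem_compositions k n t :
  (t \in compositions k n) = [&& size t == k, 0%N \notin t & sumn t == n].
Proof.
elim: k n t => [|k IHk] n t; first by case: n t => [|n] [|i t].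
apply/allpairsPdep/idP => /= [[i [u [ini inu ->]]] | ].
  move: ini inu; rewrite mem_iota IHk /= => ini /and3P[/eqP<- u0 /eqP eqs].
  rewrite in_cons negb_or u0 eqs eqxx /= andbT.
  by apply/andP; split; apply/eqP; lia.
case: t => [|i t] //= /and3P[].
rewrite inE negb_or => /eqP[szt] /andP[i0 t0] /eqP sumt.
exists i, t; rewrite mem_iota IHk szt t0 eqxx /=.
by split=> //; [lia | apply/eqP; lia].
Qed.

Lemma compositions_uniq k n : uniq (compositions k n).
Proof.
elim: k n => [|k IHk] n; first by case: n.
apply: allpairs_uniq_dep => [|i _|]; [exact: iota_uniq | exact: IHk |].
by move=> [i t] [j u] _ _ /= [-> ->].
Qed.

Definition num_compositions k n := size (compositions k n).

Lemma num_compositions0 n : num_compositions 0 n = (n == 0%N).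
Proof. by case: n. Qed.

Lemma num_compositionsS k n :
  num_compositions k.+1 n = (\sum_(i < n) num_compositions k (n - i.+1))%N.
Proof.
rewrite /num_compositions /= size_allpairs_dep sumnE !big_map.
transitivity (\sum_(1 <= i < n.+1) size (compositions k (n - i)))%N.
  by rewrite /index_iota subSS subn0.
by rewrite big_add1 big_mkord.
Qed.

Lemma num_compositions_large k n : (n < k)%N -> num_compositions k n = 0%N.
Proof.
elim: k n => [|k IHk] n ltnk //; rewrite num_compositionsS big1 // => i _.
by apply: IHk; have := ltn_ord i; lia.
Qed.

Lemma num_compositions_coef N k n : (n < N)%N ->
  (num_compositions k n)%:R =
    ((\poly_(i < N) (i != 0%N)%:R : {poly rat}) ^+ k)`_n.
Proof.
elim: k n => [|k IHk] n ltnN; first by rewrite expr0 coef1 num_compositions0.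
rewrite exprS coefM big_ord_recl coef_poly if_same mul0r add0r.
rewrite num_compositionsS natr_sum; apply: eq_bigr => i _.
rewrite lift0 coef_poly IHk /=; last by lia.
by rewrite ifT ?mul1r //; have := ltn_ord i; lia.
Qed.

(* This is (g^(k+1))' = (k+1) g' g^k for g = x + x^2 + ... *)
Lemma num_compositions_weighted k n :
  k.+1%:R * (\sum_(i < n) i.+1%:R * (num_compositions k (n - i.+1))%:R) =
  n%:R * (num_compositions k.+1 n)%:R :> rat.
Proof.
pose g : {poly rat} := \poly_(i < n.+1) (i != 0%N)%:R.
have <- : ('X * (g ^+ k.+1)^`())`_n = n%:R * (num_compositions k.+1 n)%:R.
  rewrite coefXM (num_compositions_coef _ (ltnSn _)) -/g.
  case: n @g => [|n] g /=.
    by rewrite mul0r.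
  by rewrite coef_deriv mulr_natl.
have -> : 'X * (g ^+ k.+1)^`() = (('X * g^`()) * g ^+ k) *+ k.+1.
  by rewrite deriv_exp /= -mulrnAl; ring.
rewrite coefMn mulr_natl coefM big_ord_recl coefXM mul0r add0r.
congr (_ *+ _); apply: eq_bigr => i _; rewrite coefXM lift0 /= coef_deriv.
by rewrite coef_poly ltnS ltn_ord (num_compositions_coef (N := n.+1)) //; lia.
Qed.

(* [x^j] (1 - g)^-m for g = x + x^2 + ... *)
Definition geom_coef m j : rat :=
  \sum_(k < j.+1) 'C(m.-1 + k, k)%:R * (num_compositions k j)%:R.

Lemma geom_coef_wide N m j : (j < N)%N ->
  geom_coef m j = \sum_(k < N) 'C(m.-1 + k, k)%:R * (num_compositions k j)%:R.
Proof.
move=> ltjN; rewrite /geom_coef.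
pose F k : rat := 'C(m.-1 + k, k)%:R * (num_compositions k j)%:R.
rewrite (big_ord_widen N F) // /F.
rewrite big_mkcond /=; apply: eq_bigr => k _; case: ifPn => // nlt.
by rewrite num_compositions_large ?mulr0 // ltnNge.
Qed.

(** Put h = 1 - g. The weights r + i + 1 at x^(i+1) form the series r g + x g', so the left side is
    [x^j] (r h - x g') h^-(m+2), and x g' h^-(m+2) is x times the derivative of h^-(m+1), divided by
    m + 1. The proof compares the terms for each power of g, by Pascal's rule and absorption. *)
Lemma geom_coef_rec m r j :
  r%:R * geom_coef m.+2 j -
    \sum_(i < j) (r + i.+1)%:R * geom_coef m.+2 (j - i.+1) =
  (r%:R - j%:R / m.+1%:R) * geom_coef m.+1 j.
Proof.
have -> : \sum_(i < j) (r + i.+1)%:R * geom_coef m.+2 (j - i.+1) =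
    \sum_(k < j.+1) 'C(m.+1 + k, k)%:R * (r%:R * (num_compositions k.+1 j)%:R +
       j%:R / k.+1%:R * (num_compositions k.+1 j)%:R).
  under eq_bigr => i _.
    rewrite (@geom_coef_wide j.+1); last by have := ltn_ord i; lia.
    rewrite mulr_sumr; over.
  rewrite exchange_big /=; apply: eq_bigr => k _.
  have -> : j%:R / k.+1%:R * (num_compositions k.+1 j)%:R =
      \sum_(i < j) i.+1%:R * (num_compositions k (j - i.+1))%:R :> rat.
    rewrite mulrAC -num_compositions_weighted mulrAC divff ?mul1r //.
    by rewrite pnatr_eq0.
  rewrite num_compositionsS natr_sum mulr_sumr -big_split /= mulr_sumr.
  by apply: eq_bigr => i _; rewrite natrD; ring.
have split n : geom_coef n.+1 j = (num_compositions 0 j)%:R +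
    \sum_(k < j.+1) 'C(n + k.+1, k.+1)%:R * (num_compositions k.+1 j)%:R.
  by rewrite (@geom_coef_wide j.+2) // big_ord_recl /= addn0 bin0 mul1r.
rewrite !split.
rewrite mulrDr mulrDr [X in _ = X + _]mulrBl num_compositions0.
have -> : j%:R / m.+1%:R * ((j == 0%N) : nat)%:R = 0 :> rat.
  by case: eqP => [->|_]; rewrite ?mul0r ?mulr0.
rewrite subr0 -addrA; congr (_ + _); rewrite !mulr_sumr -sumrB.
apply: eq_bigr => k _; rewrite !addnS !addSn binS natrD.
have nz n : n.+1%:R != 0 :> rat by rewrite pnatr_eq0.
have -> : 'C((m + k).+1, k.+1)%:R =
    m.+1%:R / k.+1%:R * 'C((m + k).+1, k)%:R :> rat.
  apply: (mulfI (nz k)); rewrite mulrA mulrCA divff ?mulr1 // -!natrM.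
  by rewrite mul_bin_left; congr (_ * _)%:R; lia.
move: (nz m) (nz k); move: (m.+1%:R) (k.+1%:R) => x y x0 y0.
by field; rewrite x0 y0.
Qed.

(** * Lagrange inversion *)

Lemma reversion_low_zero (R : comNzRingType) (z : fps R) M N :
    solves_reversion z -> (2 <= N)%N -> (M <= N)%N ->
  low_zero M (fps_trunc M z - 'X - \sum_(2 <= j < N) fps_trunc M z ^+ j).
Proof.
move=> /solves_reversionP[z0 zq] le2N leMN; apply/fps_trunc_reversion => //.
by apply: (proj1 (quadratic_trunc z M)) => m _.
Qed.

(** This is x z^r = z^(r+1) - z^(r+2) - ... at x^(m+1); powers of z beyond m + 1 do not contribute,
    as z^j is divisible by x^j. *)
Lemma fps_exp_reversion (R : comNzRingType) (z : fps R) m r :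
    solves_reversion z -> (r <= m)%N ->
  fps_exp z r.+1 m.+1 =
  fps_exp z r m + \sum_(i < m - r) fps_exp z (r.+1 + i.+1) m.+1.
Proof.
move=> zsol lerm; pose p := fps_trunc m.+2 z.
have p0 : p`_0 = 0 by rewrite coef_poly; case: zsol.
rewrite (coef_fps_exp _ _ (ltnSn m.+1)) (coef_fps_exp _ _ (leqnSn m.+1)) -/p.
under eq_bigr do rewrite (coef_fps_exp _ _ (ltnSn m.+1)) -/p addSnnS exprD.
have := reversion_low_zero zsol (isT : 1 < m.+2)%N (leqnn m.+2); rewrite -/p.
move/(low_zeroM (p ^+ r))/(_ _ (ltnSn m.+1)).
rewrite !mulrBr -exprSr !coefB coefMX /= mulr_sumr coef_sum.
rewrite (big_cat_nat _ (n := (m - r).+2)) /=; [|lia|lia].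
rewrite [\sum_((m - r).+2 <= i < _) _]big1_seq ?addr0; last first.
  move=> j /andP[_]; rewrite mem_index_iota -exprD => lej.
  by apply: (@low_zeroX _ m.+2 _ _ p0) => //; lia.
rewrite !big_add1 /= big_mkord -addrA -opprD.
by move/eqP; rewrite subr_eq0 => /eqP.
Qed.

(* Lagrange inversion for x = z (1 - g(z)). The recurrence fps_exp_reversion  *)
(* is triangular in the exponent, so it determines all powers of z, and       *)
(* geom_coef_rec says that the right-hand side satisfies it.                  *)
Lemma fps_exp_lagrange (z : fps rat) m r : solves_reversion z -> (r <= m)%N ->
  m.+1%:R * fps_exp z r.+1 m.+1 = r.+1%:R * geom_coef m.+1 (m - r).
Proof.
move=> zsol; elim: m r => [|m IHm] r lerm.
  have {lerm}-> : r = 0%N by lia.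
  rewrite fps_exp_reversion // subnn /geom_coef big_ord_recl !big_ord0 !addr0.
  by rewrite /= !mul1r ?mulr1.
move rd: (m.+1 - r)%N => d; elim/ltn_ind: d r lerm rd => d IHd r lerm rd.
rewrite -rd.
have nz n : n.+1%:R != 0 :> rat by rewrite pnatr_eq0.
(* For r = 0 both sides vanish. Otherwise the outer induction applies at r - 1, since (r+1) -
   (m+1-r)/(m+1) = r (m+2)/(m+1). *)
have low : m.+2%:R * fps_exp z r m.+1 =
    (r.+1%:R - (m.+1 - r)%:R / m.+1%:R) * geom_coef m.+1 (m.+1 - r).
  case: r lerm {rd} => [|r] lerm.
    rewrite subn0 divff // subrr mul0r.
    exact: mulr0.
  rewrite subSS; apply: (mulfI (nz m)); rewrite mulrCA IHm //.
  by rewrite natrB //; field; rewrite nat1r.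
rewrite fps_exp_reversion // mulrDr low -geom_coef_rec.
have -> : m.+2%:R * (\sum_(i < m.+1 - r) fps_exp z (r.+1 + i.+1) m.+2) =
    \sum_(i < m.+1 - r) (r.+1 + i.+1)%:R * geom_coef m.+2 (m.+1 - r - i.+1).
  rewrite mulr_sumr; apply: eq_bigr => i _; have lti := ltn_ord i.
  rewrite addSn (IHd (m.+1 - (r + i.+1))%N) //; [|lia|lia].
  by rewrite subnDA.
by rewrite subrK.
Qed.

Lemma schroeder_geom_coef n :
  (schroeder n)%:R = n.+1%:R^-1 * geom_coef n.+1 n :> rat.
Proof.
have [sol _] := schroeder_reversion rat.
have := fps_exp_lagrange sol (leq0n n); rewrite subn0 mul1r => <-.
rewrite mulKf ?pnatr_eq0 // (@coef_fps_exp _ n.+2) // expr1.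
by rewrite coef_poly ltnSn.
Qed.

(** * From compositions to partitions *)

Lemma prod_count_fact_rem (s : seq nat) x m : (x < m)%N -> x \in s ->
  \prod_(j < m) (count_mem (val j) s)`! =
  (count_mem x s * \prod_(j < m) (count_mem (val j) (rem x s))`!)%N.
Proof.
move=> ltxm sx; rewrite (bigD1 (Ordinal ltxm)) //=.
rewrite [in RHS](bigD1 (Ordinal ltxm)) //=.
have /permP pc := perm_to_rem sx; rewrite mulnA; congr (_ * _)%N.
  by rewrite !pc /= eqxx.
apply: eq_bigr => j /eqP nj; rewrite pc /=; case: eqP => // xj.
by case: nj; apply: val_inj.
Qed.

(** Rearrangements are counted by their first entry x: deleting x leaves a contribution of k! times
    the multiplicity of x, and the multiplicities add up to k + 1. *)
Lemma size_permutations_count (s : seq nat) m : all (gtn m) s ->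
  (size (permutations s) * \prod_(j < m) (count_mem (val j) s)`! =
   (size s)`!)%N.
Proof.
move: {2}(size s) (erefl (size s)) => k; elim: k s => [|k IHk] s szs sm.
  by rewrite (size0nil szs) /= big1 // => j _; rewrite fact0.
have s0 : (0 < size s)%N by rewrite szs.
rewrite (perm_size (permutationsE s0)) size_allpairs_dep sumnE big_map.
rewrite big_distrl /=.
transitivity (\sum_(x <- undup s) count_mem x s * k`!)%N.
  rewrite [LHS]big_seq [RHS]big_seq; apply: eq_bigr => x.
  rewrite mem_undup => sx.
  have szr : size (rem x s) = k by rewrite size_rem // szs.
  have ltxm : (x < m)%N := allP sm x sx.
  rewrite (prod_count_fact_rem ltxm sx) mulnCA IHk ?szr //.
  by apply/allP => y /mem_rem; apply: (allP sm).
rewrite -big_distrl /= szs factS; congr (_ * _)%N.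
rewrite -szs -(perm_size (perm_count_undup s)) size_flatten sumnE !big_map.
by apply: eq_bigr => x _; rewrite size_nseq.
Qed.

Lemma leq_size_sumn (t : seq nat) : 0%N \notin t -> (size t <= sumn t)%N.
Proof.
elim: t => //= i t IHt; rewrite inE negb_or => /andP[i0 /IHt]; lia.
Qed.

Lemma leq_mem_sumn (t : seq nat) i : i \in t -> (i <= sumn t)%N.
Proof. by elim: t => //= j t IHt; rewrite inE => /predU1P[->|/IHt]; lia. Qed.

Lemma parts_inj n : injective (@parts n).
Proof. by move=> l1 l2 /(inj_map val_inj)/val_inj. Qed.

Lemma is_partition_parts n t : is_partition n t ->
  exists l : n.-bseq 'I_n.+1, parts l = t.
Proof.
case/and3P=> _ t0 /eqP sumt.
have szt : (size [seq (inord i : 'I_n.+1) | i <- t] <= n)%N.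
  by rewrite size_map -sumt leq_size_sumn.
exists (Bseq szt); rewrite /parts /= -map_comp map_id_in // => i ti /=.
by rewrite inordK // ltnS -sumt leq_mem_sumn.
Qed.

Lemma is_partition_sort n k t :
  (t \in compositions k n) = is_partition n (sort geq t) && (size t == k).
Proof.
have geq_total : total geq by move=> i j; apply: leq_total.
rewrite mem_compositions /is_partition sort_sorted //= mem_sort.
by rewrite (perm_sumn (permEl (perm_sort geq t))) andbC.
Qed.

(** Sorting sends compositions to partitions, and the fibre over a partition consists of its
    rearrangements. *)
Lemma num_compositions_permutations k n :
  num_compositions k n =
  (\sum_(l : n.-bseq 'I_n.+1 |
          is_partition n (parts l) && (size (parts l) == k))
     size (permutations (parts l)))%N.
Proof.
pose Q (l : n.-bseq 'I_n.+1) :=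
  is_partition n (parts l) && (size (parts l) == k).
have geq_trans : transitive geq by move=> i j m ji mi; apply: leq_trans mi ji.
have geq_anti : antisymmetric geq by move=> i j; rewrite andbC => /anti_leq.
have geq_total : total geq by move=> i j; apply: leq_total.
transitivity
  (\sum_(l | Q l)
      count (fun t => sort geq t == parts l) (compositions k n))%N.
  under eq_bigr do rewrite -sum1_count big_mkcond.
  rewrite exchange_big /num_compositions -sum1_size /= big_seq [RHS]big_seq.
  apply: eq_bigr => t; rewrite is_partition_sort => /andP[tp szt].
  have [l lt] := is_partition_parts tp.
  rewrite (bigD1 l) /=; last by rewrite /Q lt tp size_sort.
  rewrite lt eqxx big1 // => l' /andP[_ nl]; case: eqP => // tl'.
  by case/eqP: nl; apply: parts_inj; rewrite lt.
apply: eq_bigr => l /andP[lp szl]; rewrite -size_filter.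
apply/perm_size/uniq_perm;
  rewrite ?filter_uniq ?compositions_uniq ?permutations_uniq //.
move=> t; rewrite mem_permutations mem_filter is_partition_sort.
have sl : sort geq (parts l) = parts l.
  by apply: sorted_sort => //; case/and3P: lp.
apply/andP/idP => [[/eqP tl _] | tl]; first by rewrite -tl perm_sym perm_sort.
have /eqP tl' : sort geq t == parts l by rewrite -sl; apply/eqP/perm_sortP.
by rewrite tl' eqxx lp (perm_size tl).
Qed.

Lemma multinomial_permutations n t : is_partition n t ->
  multinomial n (size t) (num_parts t) = (size (permutations t))%:R.
Proof.
case/and3P=> _ t0 /eqP sumt.
have tn : all (gtn n.+1) t by apply/allP => i /leq_mem_sumn; rewrite sumt.
rewrite /multinomial -(size_permutations_count tn) big_add1 /= big_mkord.
(* The product in [multinomial] starts at 1; the extra index 0 contributes 0! = 1, as no part is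
   zero. *)
rewrite big_ord_recl /= (count_memPn t0) fact0 mul1n natrM natr_prod.
rewrite mulfK //; apply/prodf_neq0 => j _.
by rewrite pnatr_eq0 -lt0n fact_gt0.
Qed.

Lemma geom_coef_partitions n :
  \sum_(l : n.-bseq 'I_n.+1 | is_partition n (parts l))
     'C(n + size (parts l), size (parts l))%:R *
     multinomial n (size (parts l)) (num_parts (parts l)) =
  geom_coef n.+1 n.
Proof.
have szl (l : n.-bseq 'I_n.+1) : (size (parts l) < n.+1)%N.
  by rewrite ltnS size_map size_bseq.
(* Partitions are grouped by their number k of parts, the summation index of [geom_coef]. *)
rewrite (partition_big (fun l => inord (size (parts l)) : 'I_n.+1) xpredT) //=.
apply: eq_bigr => k _; rewrite num_compositions_permutations natr_sum mulr_sumr.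
apply: eq_big => l; first by rewrite -val_eqE /= inordK.
case/andP=> lp; rewrite -val_eqE /= inordK // => /eqP<-.
by rewrite multinomial_permutations.
Qed.

Theorem theorem3p4 :
  exists s : nat -> nat,
    (forall R : comNzRingType,
       solves_reversion (shifted_series R s) /\
       forall z : fps R, solves_reversion z -> z =1 shifted_series R s) /\
    forall n : nat,
      (forall (F : realFieldType) (P : 'I_n.+2 -> 'rV[F]_2),
         convex_polygon P -> num_dissections P = s n) /\
      (s n)%:R =
        n.+1%:R^-1 *
        \sum_(l : n.-bseq 'I_n.+1 | is_partition n (parts l))
           'C(n + size (parts l), size (parts l))%:R *
           multinomial n (size (parts l)) (num_parts (parts l)) :> rat.
Proof.
exists schroeder; split=> [R|n]; first exact: schroeder_reversion.
split=> [F P|]; first exact: num_dissections_schroeder.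
by rewrite geom_coef_partitions schroeder_geom_coef.
Qed.
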